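(* Let $f,g:\mathbb{R}^n\times[0,\infty)\to\mathbb{R}^n$ satisfy the local Lipschitz condition stated in the context. Suppose there is a constant $\bar K\in\mathbb{R}$ such that for all $x,y\in\mathbb{R}^n$ and all $t>0$ $$\langle x-y,f(x,t)-f(y,t)\rangle\le \bar K(1+t)^{-1}|x-y|^2,$$ and that there exist positive constants $K_1$ and $C$ such that for all $t>0$ and all $x\in\mathbb{R}^n$ $$\langle x,f(x,t)\rangle\le -K_1(1+t)^{-1}|x|^2,\qquad |g(x,t)|\le C(1+t)^{-K_1}.$$ If $K_1>0.5$ and $0<\Delta t<\min(|\bar K|^{-1},K_1^{-1})$, then for any initial value $Z_0=x(0)\in\mathbb{R}^n$ the backward Euler--Maruyama solution $(Z_k)_{k\ge 0}$ defined by $$Z_{k+1}=Z_k+f(Z_{k+1},(k+1)\Delta t)\,\Delta t+g(Z_k,k\Delta t)\,\Delta B_k,\qquad k=0,1,2,\dots,$$ satisfies $$\limsup_{k\to\infty}\frac{\log \mathbb{E}|Z_k|^2}{\log (k\Delta t)}\le -(2K_1-1).$$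
   Context: $(\Omega,\mathcal{F},\{\mathcal{F}_t\}_{t\ge 0},\mathbb{P})$ is a complete probability space with a filtration that is increasing and right continuous, with $\mathcal{F}_0$ containing all $\mathbb{P}$-null sets; $B(t)$ is a scalar Brownian motion on it; $|\cdot|$ is the Euclidean norm and $\langle\cdot,\cdot\rangle$ the inner product on $\mathbb{R}^n$. The scheme approximates the It\^o SDE $dx(t)=f(x(t),t)\,dt+g(x(t),t)\,dB(t)$, $t\ge 0$, with deterministic initial value $x(0)\in\mathbb{R}^n$. $\Delta t>0$ is the time step and $\Delta B_k=B((k+1)\Delta t)-B(k\Delta t)$. The scheme is implicit: under the stated assumptions, for every $t>0$ and $b\in\mathbb{R}^n$ the equation $x=f(x,t)\Delta t+b$ has a unique root $x\in\mathbb{R}^n$, and $Z_{k+1}$ is the unique root with $t=(k+1)\Delta t$ and $b=Z_k+g(Z_k,k\Delta t)\Delta B_k$. Local Lipschitz condition: for every integer $r\ge 1$ and any $t\ge 0$ there is a positive constant $\bar K_{r,t}$ such that for all $x,y\in\mathbb{R}^n$ with $\max(|x|,|y|)\le r$, $\max(|f(x,t)-f(y,t)|^2,|g(x,t)-g(y,t)|^2)\le \bar K_{r,t}|x-y|^2$. Conventions: $\log 0=-\infty$, and $|\bar K|^{-1}=+\infty$ if $\bar K=0$. *)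

(* Defs.v *)
From HB Require Import structures.
From mathcomp Require Import all_boot all_order all_algebra.
From mathcomp Require Import all_classical all_reals all_analysis.

Set Implicit Arguments.
Unset Strict Implicit.
Unset Printing Implicit Defensive.

Import Order.TTheory GRing.Theory Num.Theory.
Import numFieldNormedType.Exports.

Local Open Scope classical_set_scope.
Local Open Scope ring_scope.

Definition dotp (R : realType) (n : nat) (x y : 'rV[R]_n) : R :=
  \sum_(i < n) x 0 i * y 0 i.

(* The norm `|x| that the library puts on 'rV[R]_n is the sup norm. *)
Definition enorm (R : realType) (n : nat) (x : 'rV[R]_n) : R :=
  Num.sqrt (dotp x x).

(* Time is indexed by R; only the values at times t >= 0 are constrained. *)
Record is_filtration (d : measure_display) (T : measurableType d)
    (R : realType) (F : R -> set (set T)) : Prop := IsFiltration {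
  filtration_sigma_algebra :
    forall t, 0 <= t -> sigma_algebra [set: T] (F t);
  filtration_measurable :
    forall t, 0 <= t -> F t `<=` measurable;
  filtration_increasing :
    forall s t, 0 <= s -> s <= t -> F s `<=` F t
}.

(* The usual conditions. *)
Record usual_filtration (d : measure_display) (T : measurableType d)
    (R : realType) (P : probability T R) (F : R -> set (set T)) : Prop :=
    UsualFiltration {
  usual_is_filtration : is_filtration F;
  usual_right_continuous :
    forall t, 0 <= t -> F t = \bigcap_(s in [set s | t < s]) F s;
  usual_null_sets : P.-negligible `<=` F 0
}.

Definition adapted (d : measure_display) (T : measurableType d)
    (R : realType) (F : R -> set (set T)) (X : R -> T -> R) : Prop :=
  forall t, 0 <= t ->
    forall A : set R, measurable A -> F t (X t @^-1` A).

Definition independent_of (d : measure_display) (T : measurableType d)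
    (R : realType) (P : probability T R) (X : T -> R) (G : set (set T)) :
    Prop :=
  forall (A : set R) (E : set T), measurable A -> G E ->
    P (X @^-1` A `&` E) = (P (X @^-1` A) * P E)%E.

(* The second parameter of normal_prob is the standard deviation. *)
Record brownian_motion (d : measure_display) (T : measurableType d)
    (R : realType) (P : probability T R) (F : R -> set (set T))
    (B : R -> T -> R) : Prop := BrownianMotion {
  brownian_adapted : adapted F B;
  brownian_start : {ae P, forall w, B 0 w = 0};
  brownian_continuous :
    {ae P, forall w, {within `[0, +oo[, continuous (fun t => B t w)}};
  brownian_normal : forall s t, 0 <= s -> s < t ->
    forall A : set R, measurable A ->
      P ((fun w => B t w - B s w) @^-1` A) =
      normal_prob 0 (Num.sqrt (t - s)) A;
  brownian_independent : forall s t, 0 <= s -> s < t ->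
    independent_of P (fun w => B t w - B s w) (F s)
}.

Definition local_lipschitz (R : realType) (n : nat)
    (f g : 'rV[R]_n -> R -> 'rV[R]_n) : Prop :=
  forall (r : nat) (t : R), (1 <= r)%N -> 0 <= t ->
    exists2 K : R, 0 < K &
      forall x y : 'rV[R]_n, Num.max (enorm x) (enorm y) <= r%:R ->
        Num.max (enorm (f x t - f y t) ^+ 2) (enorm (g x t - g y t) ^+ 2)
          <= K * enorm (x - y) ^+ 2.

(* Implicit in Z k.+1.  When f satisfies a one-sided Lipschitz condition
   whose constant times dt is less than 1, these equations determine Z. *)
Definition backward_euler_maruyama (T : Type) (R : realType) (n : nat)
    (f g : 'rV[R]_n -> R -> 'rV[R]_n) (B : R -> T -> R) (dt : R)
    (x0 : 'rV[R]_n) (Z : nat -> T -> 'rV[R]_n) : Prop :=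
  (forall w, Z 0%N w = x0) /\
  (forall k w,
    Z k.+1 w = Z k w + dt *: f (Z k.+1 w) (k.+1%:R * dt)
      + (B (k.+1%:R * dt) w - B (k%:R * dt) w) *: g (Z k w) (k%:R * dt)).

(* Main.v *)
Require Import Defs.
From HB Require Import structures.
From mathcomp Require Import all_boot all_order all_algebra.
From mathcomp Require Import all_classical all_reals all_analysis.
From mathcomp Require Import measurable_realfun ring lra.

Set Implicit Arguments.
Unset Strict Implicit.
Unset Printing Implicit Defensive.

Import Order.TTheory GRing.Theory Num.Theory.
Import numFieldNormedType.Exports.

Local Open Scope classical_set_scope.
Local Open Scope ring_scope.

(** Write t_k = k dt and a_k for the second moment of Z_k.  Pairing the implicit
    equation with Z_{k+1} and using the dissipativity of the drift gives, path
    by path,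
      (1 + 2 K1 dt / (1 + t_{k+1})) |Z_{k+1}|^2 <= |Z_k + dB g(Z_k, t_k)|^2.
    Expanding the square and taking expectations, the term in <Z_k, g> dB
    vanishes, and the bound on the diffusion coefficient leaves, for k >= 1,
      (1 + 2 K1 dt / (1 + t_{k+1})) a_{k+1} <= a_k + D (1 + t_k)^(-2 K1).
    The value of the second moment of dB only enters the constant D, so its
    finiteness suffices.  For p = 2 K1 > 1 and M large the sequence
    M (1 + t_k)^(-(p - 1)) is eventually a supersolution of this recursion
    (decay_recursion), so a_k is of order at most t_k^(-(2 K1 - 1)), and taking
    logarithms finishes the proof.

    The probabilistic point is the vanishing of the cross term.  It needs
    Z_k to be measurable with respect to the sigma-algebra at time t_k, although
    Z_{k+1} is only given implicitly, by Phi(Z_{k+1}) = Z_k + dB g(Z_k, t_k)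
    with Phi(x) = x - dt f(x, t_{k+1}).  The one-sided Lipschitz condition on f
    makes Phi strongly monotone, so each coordinate of x is a Lipschitz function
    of Phi(x) on the range of Phi, and McShane's formula extends it to a
    continuous function on the whole space (mcshane_extension).  Hence adaptedness
    propagates from Z_k to Z_{k+1}.  Given this measurability, independence and the symmetry of
    the Gaussian law show that the pairs (<Z_k, g>, dB) and (<Z_k, g>, -dB) have
    the same law, hence that the expectation of the product equals its own
    opposite (Rintegral_mul_symmetric_eq0). *)

(** * Euclidean norm and Lipschitz functions *)

Section euclidean.
Variables (R : realType) (n : nat).
Implicit Types x y : 'rV[R]_n.

Lemma dotp_ge0 x : 0 <= dotp x x.
Proof. by apply: sumr_ge0 => i _; rewrite -expr2 sqr_ge0. Qed.

Lemma enorm_sqr x : enorm x ^+ 2 = dotp x x.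
Proof. by rewrite sqr_sqrtr// dotp_ge0. Qed.

Lemma enorm_ge0 x : 0 <= enorm x.
Proof. exact: sqrtr_ge0. Qed.

Lemma dotpDr x y z : dotp x (y + z) = dotp x y + dotp x z.
Proof.
by rewrite -big_split/=; apply: eq_bigr => i _; rewrite mxE mulrDr.
Qed.

Lemma dotpZr a x y : dotp x (a *: y) = a * dotp x y.
Proof. by rewrite mulr_sumr; apply: eq_bigr => i _; rewrite mxE mulrCA. Qed.

Lemma dotpC x y : dotp x y = dotp y x.
Proof. by apply: eq_bigr => i _; rewrite mulrC. Qed.

Lemma enorm_sqrD x y :
  enorm (x + y) ^+ 2 = enorm x ^+ 2 + 2 * dotp x y + enorm y ^+ 2.
Proof. by rewrite !enorm_sqr dotpDr ![dotp (x + y) _]dotpC !dotpDr [dotp y x]dotpC; ring. Qed.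

Lemma enorm_sqrZ a x : enorm (a *: x) ^+ 2 = a ^+ 2 * enorm x ^+ 2.
Proof. by rewrite !enorm_sqr dotpZr dotpC dotpZr mulrA -expr2. Qed.

(** Young's inequality; it is the only comparison of a scalar product with
    norms used below. *)
Lemma le_dotp_enorm x y : 2 * dotp x y <= enorm x ^+ 2 + enorm y ^+ 2.
Proof.
have := sqr_ge0 (enorm (x + (-1) *: y)).
by rewrite enorm_sqrD enorm_sqrZ dotpZr; lra.
Qed.

Lemma le_norm_dotp_enorm x y : 2 * `|dotp x y| <= enorm x ^+ 2 + enorm y ^+ 2.
Proof.
have [_|_] := ger0P (dotp x y); first exact: le_dotp_enorm.
have := le_dotp_enorm x (-1 *: y).
by rewrite enorm_sqrZ dotpZr; lra.
Qed.

Lemma coord_le_enorm x i : `|x 0 i| <= enorm x.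
Proof.
rewrite -(sqrtr_sqr (x 0 i)) ler_sqrt ?dotp_ge0// /dotp (bigD1 i)//= -expr2 lerDl.
by apply: sumr_ge0 => j _; rewrite -expr2 sqr_ge0.
Qed.

Lemma coord_le_norm x i : `|x 0 i| <= `|x|.
Proof.
rewrite [leRHS]mx_normrE.
exact: (le_bigmax 0 (fun p : 'I_1 * 'I_n => `|x p.1 p.2|) (0, i)).
Qed.

Lemma enorm_le_norm x : enorm x <= Num.sqrt n%:R * `|x|.
Proof.
rewrite -[X in _ * X]ger0_norm// -sqrtr_sqr -sqrtrM// ler_sqrt; last first.
  by rewrite mulr_ge0// sqr_ge0.
rewrite -[X in X%:R]card_ord mulr_natl -sumr_const; rewrite /dotp; apply: ler_sum => i _.
rewrite -expr2 -real_normK ?num_real// lerXn2r ?nnegrE// ?coord_le_norm//.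
Qed.

(** Young's inequality applied to c x and y: the left-hand side of the
    assumption, multiplied by 2 c, is at most c^2 |x|^2 + |y|^2. *)
Lemma enorm_le_of_monotone (c : R) x y : 0 <= c ->
  c * enorm x ^+ 2 <= dotp x y -> c * enorm x <= enorm y.
Proof.
move=> c0 h; rewrite -(@ler_pXn2r _ 2)// ?nnegrE ?enorm_ge0 ?mulr_ge0 ?enorm_ge0//.
have := le_dotp_enorm (c *: x) y; rewrite dotpC dotpZr enorm_sqrZ exprMn dotpC.
have := ler_wpM2l c0 h; rewrite mulrA; lra.
Qed.
End euclidean.

Lemma lipschitz_at_continuous (R : realType) (V : normedModType R)
    (u : V -> R) (x : V) (L : R) : 0 <= L ->
  (forall y, `|x - y| <= 1 -> `|u x - u y| <= L * `|x - y|) ->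
  {for x, continuous u}.
Proof.
move=> L0 hu; have L1 : 0 < L + 1 by rewrite ltr_wpDl.
apply/cvgrPdist_le => e e0.
have /cvgrPdist_le xx : id @ x --> x by exact: cvg_id.
apply: filterS2 (xx _ ltr01) (xx _ (divr_gt0 e0 L1)) => y /= /hu huy.
rewrite ler_pdivlMr// => xye; apply: (le_trans huy).
have := normr_ge0 (x - y); lra.
Qed.

(** If u is L-Lipschitz as a function of Phi, then u factors through a
    continuous function defined on all of V, namely the lower envelope
    v |-> inf_a (u a + L |v - Phi a|) of the cones above the graph. *)
Lemma mcshane_extension (R : realType) (V : normedModType R) (I : Type)
    (Phi : I -> V) (u : I -> R) (L : R) : 0 <= L ->
  (forall a b, `|u a - u b| <= L * `|Phi a - Phi b|) ->
  exists2 h : V -> R, continuous h & forall a, h (Phi a) = u a.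
Proof.
move=> L0 hu.
have [[a0]|noI] := pselect (inhabited I); last first.
  exists (fun=> 0) => [v|a]; first exact: cvg_cst.
  by exfalso; apply: noI.
pose S v := [set u a + L * `|v - Phi a| | a in [set: I]].
have Slb v a b : u b - L * `|v - Phi b| <= u a + L * `|v - Phi a|.
  have := hu b a; rewrite ler_norml => /andP[_].
  have := ler_wpM2l L0 (ler_distD v (Phi b) (Phi a)).
  rewrite (distrC (Phi b) v); lra.
have S0 v : has_inf (S v).
  split; first by exists (u a0 + L * `|v - Phi a0|), a0.
  by exists (u a0 - L * `|v - Phi a0|) => _ [a _ <-]; exact: Slb.
pose h v := inf (S v).
have hle v w : h v <= h w + L * `|v - w|.
  rewrite -lerBlDr; apply: lb_le_inf; first exact: (S0 w).1.
  move=> _ [a _ <-]; rewrite lerBlDr.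
  apply: (@le_trans _ _ (u a + L * `|v - Phi a|)).
    by apply: ge_inf; [exact: (S0 v).2|exists a].
  have := ler_wpM2l L0 (ler_distD w v (Phi a)); lra.
exists h => [v|a].
  apply: (lipschitz_at_continuous L0) => w _.
  have := hle v w; have := hle w v; rewrite (distrC w v) => h1 h2.
  by rewrite ler_norml; apply/andP; split; lra.
apply/eqP; rewrite eq_le; apply/andP; split.
  apply: ge_inf; first exact: (S0 _).2.
  by exists a => //; rewrite subrr normr0 mulr0 addr0.
apply: lb_le_inf; first exact: (S0 _).1.
by move=> _ [b _ <-]; have := Slb (Phi a) b a; rewrite subrr normr0; lra.
Qed.

(** * Measurability of continuous functions of random vectors *)

Section measurability.
Variables (R : realType) (n : nat) (d : measure_display) (S : measurableType d).

(** Boxes with rational data: a countable base of the topology, whose preimages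
    under a map with measurable coordinates are finite intersections of
    measurable sets. *)
Definition rat_box (q : 'rV[rat]_n * rat) : set 'rV[R]_n :=
  [set v | forall i, `|v 0 i - ratr (q.1 0 i)| < ratr q.2].

Lemma open_rat_box (U : set 'rV[R]_n) v : open U -> U v ->
  exists2 q, rat_box q v & rat_box q `<=` U.
Proof.
move=> oU Uv.
have /nbhs_ballP[e /= e0 eU] : nbhs v U by exact: open_nbhs_nbhs.
have [r r0 re] : exists2 r : rat, 0 < ratr r :> R & 2 * ratr r <= e.
  have [r] := rat_in_itvoo (divr_gt0 e0 (ltr0n R 2)).
  rewrite in_itv/= => /andP[r0 re]; exists r => //.
  by rewrite mulrC -ler_pdivlMr// ltW.
have cq i : exists c : rat, `|v 0 i - ratr c| < ratr r.
  have [c] : exists c : rat, ratr c \in `]v 0 i, (v 0 i + ratr r)[.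
    by apply: rat_in_itvoo; rewrite ltrDl.
  rewrite in_itv/= => /andP[c1 c2]; exists c; rewrite distrC ger0_norm; lra.
have [c hc] := choice cq.
exists (\row_i c i, r) => [i|w hw]; first by rewrite /= mxE; exact: hc.
apply: eU; split => // i j; rewrite (ord1 i).
have := hw j; have := hc j; rewrite /= mxE !ltr_norml => /andP[h1 h2] /andP[h3 h4].
by rewrite /ball/= ltr_norml; apply/andP; split; lra.
Qed.

(** The preimage of a half-line under phi is open, hence a countable union of
    rational boxes.  The domain S is arbitrary so that the lemma applies to
    sub-sigma-algebras of the probability space. *)
Lemma measurable_continuous_vec (X : S -> 'rV[R]_n) (phi : 'rV[R]_n -> R) :
  (forall i, measurable_fun [set: S] (fun w => X w 0 i)) -> continuous phi ->
  measurable_fun [set: S] (phi \o X).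
Proof.
move=> mX cphi.
apply: (measurability (@RGenOInfty.G R)) => [|/= _ [_] [y] -> <-].
  exact: RGenOInfty.measurableE.
rewrite setTI; set U := phi @^-1` `]y, +oo[.
have oU : open U by apply: open_comp => [? _|]; [exact: cphi|exact: interval_open].
have -> : (phi \o X) @^-1` `]y, +oo[ = \bigcup_q
    (if `[< rat_box q `<=` U >] then X @^-1` (rat_box q) else set0).
  rewrite predeqE => w; split => [Uw|[q _]].
    have [q qw qU] := open_rat_box oU Uw.
    by exists q => //; rewrite asboolT.
  by case: asboolP => // qU; exact: qU.
apply: countable_bigcupT_measurable => [|q]; first exact: countableP.
case: ifP => // _.
have -> : X @^-1` rat_box q = \bigcap_(i in [set: 'I_n])
    ((fun w => X w 0 i) @^-1` [set x | `|x - ratr (q.1 0 i)| < ratr q.2]).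
  by rewrite predeqE => w; split => [h i _|h i]; [exact: h|exact: h].
apply: fin_bigcap_measurable => // i _.
rewrite -[X in measurable X]setTI; apply: mX => //.
rewrite (_ : [set _ | _] = ball (ratr (q.1 0 i) : R) (ratr q.2)).
  exact: measurable_ball.
by rewrite predeqE => x; rewrite /ball/= distrC.
Qed.
End measurability.

Section subfield_measurability.
Variables (d : measure_display) (T : measurableType d) (R : realType).
Implicit Types (G H : set (set T)) (X : T -> R).

(** The sigma-algebra generated by G is put on a copy of T, so that the closure
    properties of measurable functions apply to each sigma-algebra of a
    filtration. *)
Definition measurable_wrt G X :=
  measurable_fun [set: g_sigma_algebraType G] (X : g_sigma_algebraType G -> R).

Lemma measurable_wrtP G X : sigma_algebra [set: T] G ->
  measurable_wrt G X <-> forall A : set R, measurable A -> G (X @^-1` A).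
Proof.
move=> sG; split => [mX A mA|hX _ A mA].
  rewrite -(measurable_g_measurableTypeE sG) -[X in measurable X]setTI.
  exact: mX.
by rewrite setTI measurable_g_measurableTypeE//; exact: hX.
Qed.

Lemma sub_measurable_wrt G H X : G `<=` H ->
  measurable_wrt G X -> measurable_wrt H X.
Proof.
move=> GH mX _ A mA; have := mX measurableT A mA.
apply: sub_smallest2r; last exact: GH.
exact: smallest_sigma_algebra.
Qed.

Lemma measurable_wrt_measurable_fun G X : G `<=` measurable ->
  measurable_wrt G X -> measurable_fun [set: T] X.
Proof.
move=> Gm mX _ A mA; have := mX measurableT A mA.
apply: smallest_sub; last exact: Gm.
exact: sigma_algebra_measurable.
Qed.
End subfield_measurability.

(** Continuity is for the sup norm, whereas the Lipschitz bound is Euclidean and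
    only holds on a ball: the radius r covers the sup-norm unit ball at x. *)
Lemma local_lipschitz_continuous (R : realType) (n : nat)
    (f g : 'rV[R]_n -> R -> 'rV[R]_n) (t : R) (i : 'I_n) :
  local_lipschitz f g -> 0 <= t -> continuous (fun x => g x t 0 i).
Proof.
move=> hlip t0 x.
pose r := (Num.bound (Num.sqrt n%:R * (`|x| + 1))).+1.
have rE : Num.sqrt n%:R * (`|x| + 1) <= r%:R :> R.
  apply: (@le_trans _ _ (Num.bound (Num.sqrt n%:R * (`|x| + 1)))%:R).
    by rewrite ltW// archi_boundP// mulr_ge0// addr_ge0.
  by rewrite ler_nat.
have [K K0 hK] := hlip r t isT t0.
have sn0 : 0 <= Num.sqrt n%:R :> R by exact: sqrtr_ge0.
pose L := Num.sqrt K * Num.sqrt n%:R.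
have L0 : 0 <= L by rewrite mulr_ge0// sqrtr_ge0.
apply: (lipschitz_at_continuous L0) => y xy1.
have yr : `|y| <= `|x| + 1.
  by have := ler_distD x 0 y; rewrite !sub0r !normrN; lra.
have xyr : Num.max (enorm x) (enorm y) <= r%:R.
  rewrite ge_max; apply/andP; split; apply: le_trans rE;
    by rewrite (le_trans (enorm_le_norm _))// ler_wpM2l// lerDl.
have := hK x y xyr; rewrite ge_max => /andP[_ hg].
have : enorm (g x t - g y t) <= Num.sqrt K * enorm (x - y).
  have h0 : 0 <= Num.sqrt K * enorm (x - y).
    by rewrite mulr_ge0 ?sqrtr_ge0 ?enorm_ge0.
  rewrite -(@ler_pXn2r _ 2)// ?nnegrE ?enorm_ge0//.
  by rewrite exprMn (sqr_sqrtr (ltW K0)).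
have := coord_le_enorm (g x t - g y t) i; rewrite !mxE.
have := ler_wpM2l (sqrtr_ge0 K) (enorm_le_norm (x - y)).
rewrite mulrA -/L; lra.
Qed.

(** A strongly monotone map is injective with Lipschitz inverse on its range;
    each coordinate of the inverse extends continuously. *)
Lemma implicit_map_coord_inverse (R : realType) (n : nat)
    (F : 'rV[R]_n -> 'rV[R]_n) (c : R) (i : 'I_n) : 0 < c ->
  (forall x y, c * enorm (x - y) ^+ 2 <= dotp (x - y) (F x - F y)) ->
  exists2 h : 'rV[R]_n -> R, continuous h & forall x, h (F x) = x 0 i.
Proof.
move=> c0 hF; apply: (@mcshane_extension _ _ _ F (fun x => x 0 i) (c^-1 * Num.sqrt n%:R)).
  by rewrite mulr_ge0 ?sqrtr_ge0// invr_ge0 ltW.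
move=> x y; have := coord_le_enorm (x - y) i; rewrite !mxE => /le_trans; apply.
rewrite -mulrA mulrC ler_pdivlMr// mulrC.
exact: le_trans (enorm_le_of_monotone (ltW c0) (hF x y)) (enorm_le_norm _).
Qed.

(** * Centered Gaussian laws *)

Section gaussian_moments.
Variables (R : realType) (s : R).
Hypothesis s0 : s != 0.
Local Notation mu := (@lebesgue_measure R).

(** Reflection preserves both the Lebesgue measure and the centered density. *)
Lemma normal_probN (A : set R) : measurable A ->
  normal_prob 0 s (-%R @^-1` A) = normal_prob 0 s A.
Proof.
move=> mA; rewrite /normal_prob.
have mN : measurable_fun setT (-%R : R -> measurableTypeR R) by exact: oppr_measurable.
have -> : (\int[mu]_(x in A) (normal_pdf 0 s x)%:E
    = \int[pushforward mu (-%R : R -> measurableTypeR R)]_(x in A) (normal_pdf 0 s x)%:E)%E.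
  by apply: eq_measure_integral => B mB _; exact/esym/lebesgue_measureN.
rewrite ge0_integral_pushforward//; last 2 first.
- apply/measurable_funTS/measurable_EFinP; exact: measurable_normal_pdf.
- by move=> x _; rewrite lee_fin normal_pdf_ge0.
apply: eq_integral => x _ /=.
by rewrite !normal_pdfE// /normal_fun !subr0 sqrrN.
Qed.

(** The density is almost everywhere the Radon-Nikodym derivative, since both
    integrate to the same measure. *)
Lemma ge0_integral_normal_prob (h : R -> \bar R) : (forall x, (0 <= h x)%E) ->
  measurable_fun setT h ->
  (\int[normal_prob 0 s]_x h x = \int[mu]_x (h x * (normal_pdf 0 s x)%:E))%E.
Proof.
move=> h0 mh.
rewrite -(Radon_Nikodym_SigmaFinite.change_of_variables (normal_prob_dominates 0 s))//=.
have mpdf : measurable_fun setT (EFin \o normal_pdf 0 s).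
  by apply/measurable_EFinP; exact: measurable_normal_pdf.
have irn := Radon_Nikodym_SigmaFinite.f_integrable (normal_prob_dominates (0 : R) s).
apply: ae_eq_integral => //.
- by apply: emeasurable_funM => //; exact: measurable_int irn.
- exact: emeasurable_funM.
- apply: ae_eqe_mul2l => /=.
  apply: integral_ae_eq => //= E _ mE.
  by rewrite -Radon_Nikodym_SigmaFinite.f_integral//; exact: normal_prob_dominates.
Qed.

(** Since y <= exp y for y = x^2 / (4 s^2), half of the Gaussian exponent absorbs
    the square: the integrand is at most a multiple of the density of standard
    deviation sqrt 2 * s. *)
Lemma normal_prob_sqr_lty : (\int[normal_prob 0 s]_x (x ^+ 2)%:E < +oo)%E.
Proof.
rewrite ge0_integral_normal_prob; last 2 first.
- by move=> x; rewrite lee_fin sqr_ge0.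
- by apply/measurable_EFinP; exact: measurable_funX.
pose s' := Num.sqrt 2 * s.
have s2 : 0 < s ^+ 2 by rewrite exprn_even_gt0.
have s'0 : s' != 0 by rewrite mulf_neq0// sqrtr_eq0 -ltNge.
have s'2 : s' ^+ 2 = 2 * s ^+ 2 by rewrite exprMn sqr_sqrtr.
pose c := normal_peak s * (4 * s ^+ 2) / normal_peak s'.
have c0 : 0 <= c.
  by rewrite divr_ge0 ?normal_peak_ge0// mulr_ge0 ?normal_peak_ge0// mulr_ge0 ?sqr_ge0.
apply: (@le_lt_trans _ _ (\int[mu]_x (c%:E * (normal_pdf 0 s' x)%:E))%E).
  apply: ge0_le_integral => //=.
  - by move=> x _; rewrite lee_fin mulr_ge0 ?sqr_ge0 ?normal_pdf_ge0.
  - apply/measurable_EFinP; apply: measurable_funM; first exact: measurable_funX.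
    exact: measurable_normal_pdf.
  - apply/measurable_EFinP; apply: measurable_funM => //.
    exact: measurable_normal_pdf.
  move=> x _; rewrite -EFinM lee_fin !normal_pdfE// /normal_fun !subr0 s'2.
  rewrite /c [leRHS]mulrA divfK ?gt_eqF ?normal_peak_gt0//.
  rewrite mulrCA -[leRHS]mulrA ler_wpM2l ?normal_peak_ge0//.
  set y := x ^+ 2 / (4 * s ^+ 2).
  have y0 : 0 <= y by rewrite divr_ge0 ?sqr_ge0// mulr_ge0 ?sqr_ge0.
  have -> : - x ^+ 2 / (s ^+ 2 *+ 2) = - y + - y by rewrite /y; field.
  have -> : - x ^+ 2 / (2 * s ^+ 2 *+ 2) = - y by rewrite /y; field.
  have -> : x ^+ 2 = 4 * s ^+ 2 * y by rewrite /y; field.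
  have s4 : 0 < 4 * s ^+ 2 by apply: mulr_gt0.
  rewrite expRD -[leLHS]mulrA (ler_pM2l s4).
  rewrite mulrA ler_piMl ?expR_ge0// expRN ler_pdivrMr ?expR_gt0// mul1r.
  by rewrite (le_trans _ (expR_ge1Dx _))// lerDr.
rewrite integralZl//; last exact: integrable_normal_pdf.
by rewrite integral_normal_pdf mule1 ltry.
Qed.
End gaussian_moments.

(** * Second moments under a symmetric independent perturbation *)

Section second_moment.
Variables (d : measure_display) (T : measurableType d) (R : realType).
Variable P : probability T R.

(** The laws of (X, Y) and (X, -Y) agree on rectangles by independence and
    symmetry of Y, hence everywhere; so the integral of X Y equals that of
    - X Y. *)
Lemma Rintegral_mul_symmetric_eq0 (X Y : T -> R) :
  measurable_fun [set: T] X -> measurable_fun [set: T] Y ->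
  (forall A B : set R, measurable A -> measurable B ->
    P (X @^-1` A `&` Y @^-1` B) = (P (X @^-1` A) * P (Y @^-1` B))%E) ->
  (forall B : set R, measurable B ->
    P ((fun w => - Y w) @^-1` B) = P (Y @^-1` B)) ->
  P.-integrable [set: T] (EFin \o (fun w => X w * Y w)) ->
  \int[P]_w (X w * Y w) = 0.
Proof.
move=> mX mY indep symY iXY.
pose phi1 w := (X w, Y w); pose phi2 w := (X w, - Y w).
have mNY : measurable_fun [set: T] (fun w => - Y w) by exact: measurableT_comp.
have mphi1 : measurable_fun [set: T] phi1 by exact: measurable_fun_pair.
have mphi2 : measurable_fun [set: T] phi2 by exact: measurable_fun_pair.
have eq_law A : measurable A -> pushforward P phi1 A = pushforward P phi2 A.
  pose C : set (set (R * R)) :=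
    [set A | exists2 A1, measurable A1 & exists2 A2, measurable A2 & A = A1 `*` A2].
  (* Rectangles are stable under intersection and generate the product. *)
  apply: (measure_unique C (fun=> setT)) => //.
  - rewrite measurable_prod_measurableType//; congr (<<s _ >>).
    rewrite predeqE => E; split => [[A1 mA1 [A2 mA2 <-]]|[A1 mA1 [A2 mA2 ->]]].
      by exists A1 => //; exists A2.
    by exists A1 => //; exists A2.
  - move=> _ _ [A1 mA1 [A2 mA2 ->]] [B1 mB1 [B2 mB2 ->]].
    rewrite -setXI; exists (A1 `&` B1); first exact: measurableI.
    by exists (A2 `&` B2) => //; exact: measurableI.
  - by move=> _; exists setT => //; exists setT => //; rewrite setXTT.
  - by rewrite bigcup_const//; exists 0%N.
  - move=> _ [A1 mA1 [A2 mA2 ->]].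
    have mA2N : measurable (-%R @^-1` A2 : set R).
      by rewrite -[X in measurable X]setTI; exact: oppr_measurable.
    rewrite /pushforward.
    transitivity (P (X @^-1` A1 `&` Y @^-1` A2)) => //.
    transitivity (P (X @^-1` A1 `&` (fun w => - Y w) @^-1` A2)) => //.
    by rewrite indep// (indep _ _ mA1 mA2N) -symY.
  - by move=> _; rewrite -[ltLHS]/(P setT) probability_setT ltry.
pose mul := EFin \o (fun z : R * R => z.1 * z.2).
have mmul : measurable_fun setT mul.
  by apply/measurable_EFinP; apply: measurable_funM.
have iNXY : P.-integrable [set: T] (mul \o phi2).
  apply: eq_integrable (integrableN iXY) => //= w _.
  by rewrite /mul/= mulrN EFinN.
have : \int[P]_w (X w * Y w) = \int[P]_w (-1 * (X w * Y w)).
  rewrite /Rintegral; congr fine.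
  transitivity (\int[pushforward P phi1]_z mul z)%E.
    by rewrite (integral_pushforward mphi1 mmul).
  transitivity (\int[pushforward P phi2]_z mul z)%E.
    by apply: eq_measure_integral => A mA _; exact: eq_law.
  rewrite (integral_pushforward mphi2 mmul)//.
  by apply: eq_integral => w _; rewrite /mul/= mulN1r mulrN.
rewrite RintegralZl//; lra.
Qed.

(** Integrating the expansion of |U + Y G|^2: the cross term has mean zero, and
    its integrability comes from 2 |<U, Y G>| <= |U|^2 + gam Y^2. *)
Lemma second_moment_step (n : nat) (U V G : T -> 'rV[R]_n) (Y : T -> R)
    (q gam : R) : 0 <= q ->
  (forall w, (1 + q) * enorm (V w) ^+ 2 <= enorm (U w + Y w *: G w) ^+ 2) ->
  (forall w, enorm (G w) ^+ 2 <= gam) ->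
  measurable_fun [set: T] (fun w => enorm (V w) ^+ 2) ->
  measurable_fun [set: T] (fun w => dotp (U w) (G w)) ->
  measurable_fun [set: T] Y ->
  (forall A B : set R, measurable A -> measurable B ->
    P ((fun w => dotp (U w) (G w)) @^-1` A `&` Y @^-1` B) =
    (P ((fun w => dotp (U w) (G w)) @^-1` A) * P (Y @^-1` B))%E) ->
  (forall B : set R, measurable B ->
    P ((fun w => - Y w) @^-1` B) = P (Y @^-1` B)) ->
  P.-integrable [set: T] (EFin \o (fun w => enorm (U w) ^+ 2)) ->
  P.-integrable [set: T] (EFin \o (fun w => Y w ^+ 2)) ->
  P.-integrable [set: T] (EFin \o (fun w => enorm (V w) ^+ 2)) /\
  (1 + q) * \int[P]_w (enorm (V w) ^+ 2) <=
    \int[P]_w (enorm (U w) ^+ 2) + gam * \int[P]_w (Y w ^+ 2).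
Proof.
move=> q0 hV hG mV mX mY indep symY iU iY.
have igY : P.-integrable [set: T] (EFin \o (fun w => gam * Y w ^+ 2)).
  exact: (integrableZl measurableT gam iY).
have iUY : P.-integrable [set: T]
    (EFin \o (fun w => enorm (U w) ^+ 2 + gam * Y w ^+ 2)).
  exact: (integrableD measurableT iU igY).
have leG w : enorm (Y w *: G w) ^+ 2 <= gam * Y w ^+ 2.
  by rewrite enorm_sqrZ mulrC ler_wpM2r ?sqr_ge0.
have iX : P.-integrable [set: T] (EFin \o (fun w => dotp (U w) (G w) * Y w)).
  apply: le_integrable iUY => //.
    by apply/measurable_EFinP; exact: measurable_funM.
  move=> w _; rewrite lee_fin.
  have := le_norm_dotp_enorm (U w) (Y w *: G w).
  rewrite dotpZr (mulrC (Y w)) => h; apply: (le_trans _ (ler_norm _)).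
  have := leG w; have := normr_ge0 (dotp (U w) (G w) * Y w); lra.
have i2X : P.-integrable [set: T]
    (EFin \o (fun w => 2 * (dotp (U w) (G w) * Y w))) by exact: (integrableZl measurableT 2 iX).
have iR : P.-integrable [set: T] (EFin \o (fun w =>
    enorm (U w) ^+ 2 + gam * Y w ^+ 2 + 2 * (dotp (U w) (G w) * Y w))).
  exact: (integrableD measurableT iUY i2X).
have leV w : (1 + q) * enorm (V w) ^+ 2 <=
    enorm (U w) ^+ 2 + gam * Y w ^+ 2 + 2 * (dotp (U w) (G w) * Y w).
  apply: (le_trans (hV w)); rewrite enorm_sqrD dotpZr (mulrC (Y w)).
  have := leG w; lra.
have iV : P.-integrable [set: T] (EFin \o (fun w => enorm (V w) ^+ 2)).
  apply: le_integrable iR => //; first exact/measurable_EFinP.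
  move=> w _; rewrite lee_fin ger0_norm ?sqr_ge0//.
  apply: (le_trans _ (ler_norm _)); apply: (le_trans _ (leV w)).
  by rewrite ler_peMl ?sqr_ge0// lerDl.
split => //.
rewrite -RintegralZl//.
have := le_Rintegral measurableT (integrableZl measurableT (1 + q) iV) iR (fun w _ => leV w).
have X0 := Rintegral_mul_symmetric_eq0 mX mY indep symY iX.
by rewrite !RintegralD// !RintegralZl// X0 mulr0 addr0.
Qed.
End second_moment.

(** * Brownian increments and the backward Euler-Maruyama scheme *)

Section brownian_increments.
Variables (d : measure_display) (T : measurableType d) (R : realType).
Variables (P : probability T R) (F : R -> set (set T)) (B : R -> T -> R).
Hypotheses (hF : is_filtration F) (hB : brownian_motion P F B).
Variables s t : R.
Hypotheses (s0 : 0 <= s) (st : s < t).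
Let Y w := B t w - B s w.
Let t0 : 0 <= t. Proof. by rewrite (le_trans s0)// ltW. Qed.
Let sd0 : Num.sqrt (t - s) != 0.
Proof. by rewrite sqrtr_eq0 -ltNge subr_gt0. Qed.

Lemma adapted_measurable_wrt u v : 0 <= u -> u <= v -> measurable_wrt (F v) (B u).
Proof.
move=> u0 uv; apply: (sub_measurable_wrt (filtration_increasing hF u0 uv)).
apply/measurable_wrtP; first exact: filtration_sigma_algebra.
exact: brownian_adapted hB _ u0.
Qed.

Lemma measurable_wrt_increment : measurable_wrt (F t) Y.
Proof.
by apply: measurable_funB; apply: adapted_measurable_wrt => //; exact: ltW.
Qed.

Lemma measurable_increment : measurable_fun [set: T] Y.
Proof.
exact: measurable_wrt_measurable_fun (filtration_measurable hF t0) measurable_wrt_increment.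
Qed.

Lemma increment_symmetric (A : set R) : measurable A ->
  P ((fun w => - Y w) @^-1` A) = P (Y @^-1` A).
Proof.
move=> mA; have mNA : measurable (-%R @^-1` A : set R).
  by rewrite -[X in measurable X]setTI; exact: oppr_measurable.
have := brownian_normal hB s0 st mNA.
by rewrite normal_probN// -(brownian_normal hB s0 st mA).
Qed.

Let integral_increment_sqr :
  (\int[P]_w (Y w ^+ 2)%:E = \int[normal_prob 0 (Num.sqrt (t - s))]_x (x ^+ 2)%:E)%E.
Proof.
(* The copy of R on which the Lebesgue measure, hence normal_prob, is defined. *)
pose YR : T -> measurableTypeR R := Y.
have mYR : measurable_fun [set: T] YR by exact: measurable_increment.
transitivity (\int[pushforward P YR]_x (x ^+ 2)%:E)%E.
  rewrite (ge0_integral_pushforward mYR)//.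
  - by apply/measurable_EFinP; exact: measurable_funX.
  - by move=> x _; rewrite lee_fin sqr_ge0.
apply: (eq_measure_integral (normal_prob 0 (Num.sqrt (t - s)))) => A mA _.
exact: (brownian_normal hB s0 st mA).
Qed.

Lemma integrable_increment_sqr :
  P.-integrable [set: T] (EFin \o (fun w => Y w ^+ 2)).
Proof.
apply/integrableP; split.
  by apply/measurable_EFinP; apply: measurable_funX; exact: measurable_increment.
under eq_integral do rewrite /= ger0_norm ?sqr_ge0//.
by rewrite integral_increment_sqr; exact: normal_prob_sqr_lty.
Qed.

Lemma Rintegral_increment_sqr :
  \int[P]_w (Y w ^+ 2) = \int[normal_prob 0 (Num.sqrt (t - s))]_x (x ^+ 2).
Proof. by congr fine; exact: integral_increment_sqr. Qed.

End brownian_increments.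

Section scheme.
Variables (R : realType) (d : measure_display) (T : measurableType d).
Variables (P : probability T R) (F : R -> set (set T)) (B : R -> T -> R).
Hypotheses (hF : is_filtration F) (hB : brownian_motion P F B).
Variables (n : nat) (f g : 'rV[R]_n -> R -> 'rV[R]_n).
Hypothesis hlip : local_lipschitz f g.
Variable Kbar : R.
Hypothesis hmono : forall (x y : 'rV[R]_n) (t : R), 0 < t ->
  dotp (x - y) (f x t - f y t) <= Kbar * (1 + t)^-1 * enorm (x - y) ^+ 2.
Variables K1 C : R.
Hypotheses (hK1 : 0 < K1) (hC : 0 < C).
Hypothesis hf : forall (x : 'rV[R]_n) (t : R), 0 < t ->
  dotp x (f x t) <= - K1 * (1 + t)^-1 * enorm x ^+ 2.
Hypothesis hg : forall (x : 'rV[R]_n) (t : R), 0 < t ->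
  enorm (g x t) <= C * (1 + t) `^ (- K1).
Variable dt : R.
Hypotheses (hdt0 : 0 < dt) (hdt : dt * `|Kbar| < 1).
Variables (x0 : 'rV[R]_n) (Z : nat -> T -> 'rV[R]_n).
Hypothesis hZ : backward_euler_maruyama f g B dt x0 Z.

Let tk (k : nat) : R := k%:R * dt.
Let tk_ge0 k : 0 <= tk k. Proof. by rewrite mulr_ge0// ltW. Qed.
Let tkS k : tk k < tk k.+1. Proof. by rewrite ltr_pM2r// ltr_nat. Qed.
Let tkS_gt0 k : 0 < tk k.+1. Proof. exact: le_lt_trans (tk_ge0 k) (tkS k). Qed.
Let dB k w := B (tk k.+1) w - B (tk k) w.

Lemma scheme_explicit_part k w :
  Z k.+1 w - dt *: f (Z k.+1 w) (tk k.+1) = Z k w + dB k w *: g (Z k w) (tk k).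
Proof. by rewrite [X in X - _](hZ.2 k w) addrAC addrK. Qed.

(** The step restriction dt |Kbar| < 1 makes the implicit map strongly monotone
    with a constant that is uniform in time. *)
Lemma scheme_implicit_map_monotone k (x y : 'rV[R]_n) :
  (1 - dt * `|Kbar|) * enorm (x - y) ^+ 2 <=
  dotp (x - y) ((x - dt *: f x (tk k.+1)) - (y - dt *: f y (tk k.+1))).
Proof.
set t := tk k.+1.
have -> : (x - dt *: f x t) - (y - dt *: f y t) =
    (x - y) + (- dt) *: (f x t - f y t).
  by rewrite scalerBr !scaleNr !opprK opprD opprK addrACA.
rewrite dotpDr dotpZr -enorm_sqr.
have h1 := ler_wpM2l (ltW hdt0) (hmono x y (tkS_gt0 k)).
have h2 : Kbar * (1 + t)^-1 <= `|Kbar|.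
  have t1 : 1 <= 1 + t by rewrite lerDl (ltW (tkS_gt0 k)).
  rewrite ler_pdivrMr ?(lt_le_trans ltr01 t1)//.
  by rewrite (le_trans (ler_norm _))// ler_peMr.
have h3 := ler_wpM2r (sqr_ge0 (enorm (x - y))) (ler_wpM2l (ltW hdt0) h2).
rewrite -/t in h1; lra.
Qed.

(** Z_{k+1} is a continuous function of Z_k + dB g(Z_k, t_k), whose terms are
    all known at time t_{k+1}. *)
Lemma scheme_adapted k i : measurable_wrt (F (tk k)) (fun w => Z k w 0 i).
Proof.
elim: k i => [|k ih] i.
  rewrite (_ : (fun w => _) = cst (x0 0 i)); first exact: measurable_cst.
  by apply/funext => w; rewrite hZ.1.
have [c0] : 0 < 1 - dt * `|Kbar| by rewrite subr_gt0.
have [h ch hE] := implicit_map_coord_inverse i c0 (@scheme_implicit_map_monotone k).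
have -> : (fun w => Z k.+1 w 0 i) =
    h \o (fun w => Z k w + dB k w *: g (Z k w) (tk k)).
  by apply/funext => w /=; rewrite -scheme_explicit_part hE.
apply: measurable_continuous_vec ch => j.
have mZ j' : measurable_wrt (F (tk k.+1)) (fun w => Z k w 0 j').
  exact: sub_measurable_wrt (filtration_increasing hF (tk_ge0 k) (ltW (tkS k))) (ih j').
under eq_fun do rewrite !mxE.
apply: measurable_funD; first exact: mZ.
apply: measurable_funM.
  exact: (measurable_wrt_increment hF hB (tk_ge0 k) (tkS k)).
exact: measurable_continuous_vec mZ (@local_lipschitz_continuous _ _ _ _ _ j hlip (tk_ge0 k)).
Qed.

(** Twice the scalar product of z = Z_{k+1} with z - dt f(z, t) is at most
    |z|^2 + |z - dt f(z, t)|^2, and at least 2 (1 + K1 dt / (1 + t)) |z|^2 by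
    dissipativity of f. *)
Lemma scheme_dissipative k w :
  (1 + 2 * K1 * dt / (1 + tk k.+1)) * enorm (Z k.+1 w) ^+ 2 <=
  enorm (Z k w + dB k w *: g (Z k w) (tk k)) ^+ 2.
Proof.
rewrite -scheme_explicit_part; set z := Z k.+1 w; set t := tk k.+1.
have := le_dotp_enorm z (z - dt *: f z t).
rewrite -scaleNr dotpDr dotpZr -[dotp z z]enorm_sqr scaleNr.
have := ler_wpM2l (ltW hdt0) (hf z (tkS_gt0 k)).
rewrite -/t; lra.
Qed.

Lemma scheme_measurable k : measurable_fun [set: T] (fun w => enorm (Z k w) ^+ 2).
Proof.
under eq_fun do rewrite enorm_sqr.
have mZ i : measurable_fun [set: T] (fun w => Z k w 0 i).
  exact: measurable_wrt_measurable_fun (filtration_measurable hF (tk_ge0 k)) (@scheme_adapted k i).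
by apply: measurable_sum => i; apply: measurable_funM; exact: mZ.
Qed.

Lemma scheme_drift_measurable k :
  measurable_wrt (F (tk k)) (fun w => dotp (Z k w) (g (Z k w) (tk k))).
Proof.
apply: measurable_sum => i; apply: measurable_funM; first exact: scheme_adapted.
exact: measurable_continuous_vec (@scheme_adapted k)
  (@local_lipschitz_continuous _ _ _ _ _ i hlip (tk_ge0 k)).
Qed.

Let vdt := \int[normal_prob 0 (Num.sqrt dt)]_x (x ^+ 2).

Lemma scheme_step k gam :
  (forall w, enorm (g (Z k w) (tk k)) ^+ 2 <= gam) ->
  P.-integrable [set: T] (EFin \o (fun w => enorm (Z k w) ^+ 2)) ->
  P.-integrable [set: T] (EFin \o (fun w => enorm (Z k.+1 w) ^+ 2)) /\
  (1 + 2 * K1 * dt / (1 + tk k.+1)) * \int[P]_w (enorm (Z k.+1 w) ^+ 2) <=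
    \int[P]_w (enorm (Z k w) ^+ 2) + gam * vdt.
Proof.
move=> hgam iZ.
have -> : vdt = \int[P]_w (dB k w ^+ 2).
  rewrite (Rintegral_increment_sqr hF hB (tk_ge0 k) (tkS k)).
  by rewrite /tk -natr1 mulrDl mul1r addrAC subrr add0r.
have sF := filtration_sigma_algebra hF (tk_ge0 k).
apply: second_moment_step hgam _ _ _ _ _ iZ _ => //.
- by rewrite divr_ge0 ?mulr_ge0 ?addr_ge0 ?(ltW hdt0) ?(ltW hK1).
- exact: scheme_dissipative.
- exact: scheme_measurable.
- exact: measurable_wrt_measurable_fun (filtration_measurable hF (tk_ge0 k))
    (@scheme_drift_measurable k).
- exact: (measurable_increment hF hB (tk_ge0 k) (tkS k)).
- move=> A E mA mE; rewrite setIC muleC.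
  apply: (brownian_independent hB (tk_ge0 k) (tkS k)) => //.
  by move/(measurable_wrtP _ sF): (@scheme_drift_measurable k); exact.
- exact: (increment_symmetric hB (tk_ge0 k) (tkS k)).
- exact: (integrable_increment_sqr hF hB (tk_ge0 k) (tkS k)).
Qed.

Lemma scheme_noise_bound k w : (0 < k)%N ->
  enorm (g (Z k w) (tk k)) ^+ 2 <= C ^+ 2 * (1 + tk k) `^ (- (2 * K1)).
Proof.
case: k => // k _; have := hg (Z k.+1 w) (tkS_gt0 k).
have -> : (1 + tk k.+1) `^ (- (2 * K1)) = ((1 + tk k.+1) `^ (- K1)) ^+ 2.
  by rewrite -powR_mulrn ?powR_ge0// -powRrM mulNr mulrC.
by rewrite -exprMn => h; rewrite lerXn2r ?nnegrE ?enorm_ge0 ?mulr_ge0 ?powR_ge0 ?(ltW hC).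
Qed.

(** The diffusion coefficient is bounded only at positive times, but at time 0 it
    is evaluated at the deterministic point x0. *)
Lemma scheme_integrable k :
  P.-integrable [set: T] (EFin \o (fun w => enorm (Z k w) ^+ 2)).
Proof.
elim: k => [|[|k] ih].
- rewrite (_ : _ \o _ = cst (enorm x0 ^+ 2)%:E).
    exact: finite_measure_integrable_cst.
  by apply/funext => w /=; rewrite hZ.1.
- apply: (scheme_step (gam := enorm (g x0 (tk 0)) ^+ 2) _ ih).1 => w.
  by rewrite hZ.1.
- exact: (scheme_step (fun w => scheme_noise_bound w (ltn0Sn k)) ih).1.
Qed.

End scheme.

(** * Decay of the recursion and upper limits *)

Lemma limn_esup_le_near (R : realType) (u : (\bar R)^nat) (l : R) :
  (forall e, 0 < e -> \forall k \near \oo, (u k <= (l + e)%:E)%E) ->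
  (limn_esup u <= l%:E)%E.
Proof.
move=> h; apply/lee_addgt0Pr => e e0.
apply: (@le_trans _ _ (ereal_sup (u @` [set k | (u k <= (l + e)%:E)%E]))).
  by apply: ereal_inf_lbound; exists [set k | (u k <= (l + e)%:E)%E]; [exact: h|].
by apply: ge_ereal_sup => _ [k /= hk <-].
Qed.

(** Put t_k = 1 + k dt, v = dt / t_k and s = p - 1, so that t_{k+1} = t_k (1 + v)
    and t_k^(-p) = t_k^(-s) v / dt.  If a_k <= M t_k^(-s) and M >= 4 D / dt, the
    right-hand side of the recursion is at most M t_k^(-s) (1 + v / 4), and the
    induction closes as soon as
      1 + v / 4 <= (1 + v)^(-s) (1 + p v / (1 + v)).
    The right-hand side is 1 + (p - s) v + O(v^2) = 1 + v + O(v^2), so this holds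
    for small v, that is, for large k. *)
Lemma decay_recursion (R : realType) (a : nat -> R) (dt p D : R) :
  0 < dt -> 1 < p -> 0 <= D ->
  (forall k, (0 < k)%N -> a k.+1 * (1 + p * dt / (1 + k.+1%:R * dt))
     <= a k + D * (1 + k%:R * dt) `^ (- p)) ->
  exists2 M, 1 <= M &
    \forall k \near \oo, a k <= M * (1 + k%:R * dt) `^ (- (p - 1)).
Proof.
move=> dt0 p1 D0 ha; set s := p - 1.
pose t (k : nat) : R := 1 + k%:R * dt.
have t0 k : 0 < t k by rewrite ltr_wpDr// mulr_ge0// ltW.
have s0 : 0 < s by rewrite subr_gt0.
(* An explicit threshold for v: it dominates the second-order terms below. *)
pose v0 : R := (1 + (2 * p) ^+ 2)^-1.
have v00 : 0 < v0 by rewrite invr_gt0 ltr_wpDr// sqr_ge0.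
have [k0 k00 hk0] : exists2 k0, (0 < k0)%N & forall k, (k0 <= k)%N -> dt / t k <= v0.
  have [m] : exists m : nat, v0^-1 <= m%:R.
    by exists (Num.bound v0^-1); rewrite ltW// archi_boundP// invr_ge0 ltW.
  move=> hm; exists m.+1 => // k mk.
  rewrite ler_pdivrMr// mulrC -ler_pdivrMr// mulrC.
  rewrite (le_trans (ler_wpM2r (ltW dt0) hm))// /t.
  apply: (@le_trans _ _ (k%:R * dt)); last by rewrite lerDr.
  by rewrite ler_wpM2r ?(ltW dt0)// ler_nat (leq_trans _ mk).
pose M := Num.max (Num.max 1 (4 * D / dt)) (a k0 / (t k0 `^ (- s))).
have M1 : 1 <= M by rewrite /M !le_max lexx.
have MD : 4 * D / dt <= M by rewrite /M !le_max lexx orbT.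
have Ma : a k0 / (t k0 `^ (- s)) <= M by rewrite /M !le_max lexx orbT.
exists M => //; exists k0 => // k /= k0k.
rewrite -/(t k); elim: k k0k => [|k ih].
  by rewrite leqn0 => /eqP k00E; rewrite k00E in k00.
rewrite leq_eqVlt => /predU1P[<-|]; first by rewrite -ler_pdivrMr// powR_gt0.
rewrite ltnS => k0k.
have {}ih := ih k0k; have {}ha := ha k (leq_trans k00 k0k).
rewrite -/(t k) -/(t k.+1) in ha.
have {hk0} := hk0 k k0k; set v := dt / t k => vv0.
have v_gt0 : 0 < v by rewrite divr_gt0.
have tS : t k.+1 = t k * (1 + v).
  rewrite mulrDr mulr1 mulrC /v divfK ?gt_eqF// /t -natr1; ring.
have c0 : 0 < 1 + p * dt / t k.+1.
  by rewrite ltr_wpDr// divr_ge0 ?(ltW (t0 _))// mulr_ge0 ?ltW//; lra.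
rewrite -(ler_pM2r c0); apply: (le_trans ha).
set x := t k `^ (- s) in ih *.
have x0 : 0 < x by rewrite powR_gt0.
have -> : t k `^ (- p) = x / t k.
  rewrite -powR_inv1 ?(ltW (t0 _))// /x -powRD; last by rewrite (gt_eqF (t0 _)) implybT.
  by congr (_ `^ _); rewrite /s; ring.
have step1 : a k + D * (x / t k) <= x * (M * (1 + v / 4)).
  have -> : D * (x / t k) = x * (4 * D / dt) * (v / 4).
    by rewrite /v; field; rewrite !gt_eqF.
  have := ler_wpM2r (ltW (divr_gt0 v_gt0 (ltr0n R 4))) (ler_wpM2l (ltW x0) MD).
  lra.
apply: (le_trans step1).
(* Bernoulli, from ln (1 + v) <= v and exp (- s v) >= 1 - s v. *)
have step2 : 1 - s * v <= (1 + v) `^ (- s).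
  rewrite /powR gt_eqF ?ltr_wpDr ?(ltW v_gt0)//.
  apply: (@le_trans _ _ (expR (- s * v))).
    by rewrite (le_trans _ (expR_ge1Dx _))// mulNr.
  rewrite ler_expR !mulNr lerN2 ler_wpM2l ?(ltW s0)//.
  by apply: le_ln1Dx; lra.
rewrite tS powRM ?(ltW (t0 _)) ?addr_ge0 ?(ltW v_gt0)// -/x.
have -> : p * dt / (t k * (1 + v)) = p * v / (1 + v).
  by rewrite /v; field; rewrite !gt_eqF// addr_gt0.
(* After multiplication by 1 + v the difference of the two sides is
   v (3 / 4 - v (1 / 4 + s (1 + p))). *)
have step3 : 1 + v / 4 <= (1 - s * v) * (1 + p * v / (1 + v)).
  rewrite -(ler_pM2r (_ : 0 < 1 + v)); last by rewrite ltr_wpDr// ltW.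
  have -> : (1 - s * v) * (1 + p * v / (1 + v)) * (1 + v) =
    (1 - s * v) * (1 + v + p * v).
    by field; rewrite gt_eqF// ltr_wpDr// ltW.
  have hv : v * (1 + (2 * p) ^+ 2) <= 1.
    by rewrite -ler_pdivlMr ?mul1r// ltr_wpDr// sqr_ge0.
  have : 0 <= v * (3 / 4 - v * (1 / 4 + s * (1 + p))).
    rewrite mulr_ge0 ?(ltW v_gt0)//.
    have : v * (s * (1 + p)) <= v * (p ^+ 2) by rewrite ler_pM2l// /s; lra.
    lra.
  rewrite /s; lra.
have M0 : 0 < M by lra.
rewrite [leRHS](_ : _ = x * (M * ((1 + v) `^ (- s) * (1 + p * v / (1 + v))))); last by ring.
rewrite ler_pM2l// ler_pM2l//; apply: (le_trans step3).
apply: ler_wpM2r => //.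
have pv0 : 0 <= p * v by rewrite mulr_ge0 ?(ltW v_gt0)//; lra.
by rewrite addr_ge0// divr_ge0//; lra.
Qed.

(** * Polynomial decay of the second moment *)

Theorem theorem3p5 (R : realType) (d : measure_display) (T : measurableType d)
    (P : probability T R) (hcomplete : measure_is_complete P)
    (F : R -> set (set T)) (hF : usual_filtration P F)
    (B : R -> T -> R) (hB : brownian_motion P F B)
    (n : nat) (f g : 'rV[R]_n -> R -> 'rV[R]_n)
    (hlip : local_lipschitz f g)
    (Kbar : R)
    (hmono : forall (x y : 'rV[R]_n) (t : R), 0 < t ->
      dotp (x - y) (f x t - f y t)
        <= Kbar * (1 + t)^-1 * enorm (x - y) ^+ 2)
    (K1 C : R) (hK1 : 0 < K1) (hC : 0 < C)
    (hf : forall (x : 'rV[R]_n) (t : R), 0 < t ->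
      dotp x (f x t) <= - K1 * (1 + t)^-1 * enorm x ^+ 2)
    (hg : forall (x : 'rV[R]_n) (t : R), 0 < t ->
      enorm (g x t) <= C * (1 + t) `^ (- K1))
    (hK1_half : 2^-1 < K1)
    (dt : R) (hdt0 : 0 < dt)
    (hdt : (dt%:E < mine (`|Kbar|%:E^-1) (K1%:E^-1))%E)
    (x0 : 'rV[R]_n) (Z : nat -> T -> 'rV[R]_n)
    (hZ : backward_euler_maruyama f g B dt x0 Z) :
  (limn_esup (fun k : nat =>
      lne 'E_P[fun w => (enorm (Z k w) ^+ 2)%R] / (ln (k%:R * dt))%:E)
    <= (- (2 * K1 - 1))%:E)%E.
Proof.
have hF' := usual_is_filtration hF.
have hdtK : dt * `|Kbar| < 1.
  have [->|K0] := eqVneq Kbar 0; first by rewrite normr0 mulr0.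
  move: hdt; rewrite lt_min => /andP[+ _].
  rewrite inver normr_eq0 (negbTE K0) lte_fin => h.
  by rewrite -ltr_pdivlMr ?normr_gt0// div1r.
pose a k := \int[P]_w (enorm (Z k w) ^+ 2).
pose v := \int[normal_prob 0 (Num.sqrt dt)]_x (x ^+ 2 : R).
have v0 : 0 <= v by apply: Rintegral_ge0 => x _; exact: sqr_ge0.
have iZ k := scheme_integrable hF' hB hlip hmono hK1 hC hf hg hdt0 hdtK hZ k.
have [] := @decay_recursion _ a dt (2 * K1) (C ^+ 2 * v) hdt0 _ _ _.
- by rewrite -ltr_pdivrMl// mulr1.
- by rewrite mulr_ge0 ?sqr_ge0.
- move=> k k0.
  have [_] := scheme_step hF' hB hlip hmono hK1 hf hdt0 hdtK hZ
    (fun w => scheme_noise_bound hC hg hdt0 Z w k0) (iZ k).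
  by rewrite -/(a k) -/(a k.+1) -/v mulrC (mulrAC _ v).
move=> M M1 [k0 _ hM].
apply: limn_esup_le_near => e e0.
set s := 2 * K1 - 1 in hM *.
have s0 : 0 < s by rewrite subr_gt0 -ltr_pdivrMl// mulr1.
(* N makes ln t >= 1 + ln M / e: then ln t > 0 and ln M <= e ln t. *)
pose N := Num.bound (expR (1 + ln M / e) / dt).
have lnM0 : 0 <= ln M by rewrite ln_ge0.
exists (maxn k0 N) => // k /=; rewrite geq_max => /andP[k0k Nk].
set t := k%:R * dt.
have tbig : expR (1 + ln M / e) <= t.
  rewrite -ler_pdivrMr//; apply: (@le_trans _ _ N%:R); last by rewrite ler_nat.
  by rewrite ltW// archi_boundP// divr_ge0 ?expR_ge0// ltW.
have t0 : 0 < t by rewrite (lt_le_trans (expR_gt0 _) tbig).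
have lnt : 1 + ln M / e <= ln t by rewrite -ler_expR lnK ?posrE.
have lnt0 : 0 < ln t by rewrite (lt_le_trans _ lnt)// ltr_pwDl// divr_ge0// ltW.
have -> : ('E_P[fun w => (enorm (Z k w) ^+ 2)%R] = (a k)%:E)%E.
  rewrite unlock fineK//; exact: (integrable_fin_num measurableT (iZ k)).
(* A vanishing second moment makes the quotient -oo. *)
have [ak0|ak0] := leP (a k) 0.
  by rewrite le0_lneNy ?lee_fin// inver gt_eqF// gt0_mulNye ?lte_fin ?invr_gt0// leNye.
rewrite lne_EFin// inver gt_eqF// -EFinM lee_fin ler_pdivrMr//.
have t1 : 0 < 1 + t by rewrite ltr_wpDl.
have : ln (a k) <= ln (M * (1 + t) `^ (- s)).
  by rewrite ler_ln ?posrE ?mulr_gt0 ?powR_gt0 ?(lt_le_trans _ M1)//; exact: hM.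
rewrite lnM ?posrE ?powR_gt0 ?(lt_le_trans _ M1)// ln_powR.
have : s * ln t <= s * ln (1 + t) by rewrite ler_pM2l// ler_ln ?posrE// lerDr.
have : ln M <= e * ln t.
  rewrite mulrC -ler_pdivrMr//; apply: le_trans lnt; by rewrite lerDr.
lra.
Qed.
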